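(* Let $\mathbb{K}$ be a field of characteristic zero, let $S=\mathbb{K}[x_1,\dots,x_n]$ with $\mathfrak{m}=(x_1,\dots,x_n)$, and let $I\subset S$ be a monomial ideal generated in degree $d$ with $\mathfrak{m}^{d+1}\subset I$. If the minimal free resolution of $S/I$ is linear for $n-2$ steps, then $S/I$ has the weak Lefschetz property.
   Context: $S$ is standard graded. ''Generated in degree $d$'' means that all minimal generators of $I$ are homogeneous of degree $d$. For an ideal $I$ generated in degree $d$, write $\beta_{i,j}(S/I)$ for the graded Betti numbers of $S/I$ over $S$; the minimal free resolution of $S/I$ is linear for $r$ steps if $\beta_{i,i+j}(S/I)=0$ for all $1\le i\le r$ and all $j\ge d$. For an artinian homogeneous ideal $I$, $S/I$ has the weak Lefschetz property (WLP) if there is a linear form $\ell\in(S/I)_1$ such that for all integers $j$ the multiplication map $\times\ell:(S/I)_j\to(S/I)_{j+1}$ has maximal rank, i.e. is injective or surjective. *)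

(* Defs.v *)
From mathcomp Require Import all_boot all_order all_algebra.
From mathcomp Require Import mpoly.

Set Implicit Arguments.
Unset Strict Implicit.
Unset Printing Implicit Defensive.

Import GRing.Theory.
Local Open Scope ring_scope.

Section Ideals.
Variables (n : nat) (K : fieldType).
Local Notation S := {mpoly K[n]}.

Definition ideal_span (G : S -> Prop) (f : S) : Prop :=
  exists2 s : seq (S * S),
    forall c, c \in s -> G c.2 & f = \sum_(c <- s) c.1 * c.2.

Definition ideal_mul (I J : S -> Prop) : S -> Prop :=
  ideal_span (fun h => exists f g, [/\ I f, J g & h = f * g]).

Definition ideal_exp (I : S -> Prop) (k : nat) : S -> Prop :=
  iter k (ideal_mul I) (fun _ => True).

Definition irrelevant_ideal : S -> Prop :=
  ideal_span (fun g => exists i : 'I_n, g = 'X_i).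

Definition monomial_ideal (I : S -> Prop) : Prop :=
  exists M : 'X_{1..n} -> Prop,
    forall f, I f <-> ideal_span (fun g => exists2 m, M m & g = 'X_[m]) f.

(* The minimal generators of a monomial ideal are the monomials it contains
   that are minimal for divisibility; [(m' <= m)%MM] says that 'X_[m'] divides
   'X_[m]. *)
Definition minimal_generator (I : S -> Prop) (m : 'X_{1..n}) : Prop :=
  I 'X_[m] /\ forall m' : 'X_{1..n}, (m' <= m)%MM -> I 'X_[m'] -> m' = m.

Definition generated_in_degree (I : S -> Prop) (d : nat) : Prop :=
  forall m, minimal_generator I m -> mdeg m = d.

(* Elements of (S/I)_j are represented by forms of degree j, equality in S/I
   being membership of the difference in I. In negative degrees S/I vanishes,
   so it is enough to let j range over nat. *)
Definition mul_injective (I : S -> Prop) (l : S) (j : nat) : Prop :=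
  forall f : S, f \is j.-homog -> I (l * f) -> I f.

Definition mul_surjective (I : S -> Prop) (l : S) (j : nat) : Prop :=
  forall g : S, g \is j.+1.-homog ->
    exists2 f : S, f \is j.-homog & I (g - l * f).

Definition weak_lefschetz (I : S -> Prop) : Prop :=
  exists2 l : S, l \is 1.-homog &
    forall j, mul_injective I l j \/ mul_surjective I l j.

End Ideals.

Section Resolutions.
Variables (n : nat) (K : fieldType).
Local Notation S := {mpoly K[n]}.

(* The data of ... -> F_1 -> F_0 -> S/I with F_i the direct sum of the
   S(-shift i k), k < rk i. Elements of F_i are row vectors, and the maps
   F_(i+1) -> F_i and F_0 -> S/I are right multiplication by [diff i] and by
   [aug] (followed by the projection S -> S/I). Shifts are natural numbers
   because the generators of a minimal resolution of S/I have nonnegative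
   degree. *)
Record free_complex := FreeComplex {
  rk : nat -> nat;
  shift : forall i, 'I_(rk i) -> nat;
  aug : 'cV[S]_(rk 0);
  diff : forall i, 'M[S]_(rk i.+1, rk i)
}.

(* The maps are homogeneous of degree 0: the entry (k, l) of [diff i] is a form
   of degree shift k - shift l, hence 0 when that number is negative. *)
Definition graded_complex (F : free_complex) : Prop :=
  (forall k, aug F k ord0 \is (shift k).-homog) /\
  (forall i (k : 'I_(rk F i.+1)) (l : 'I_(rk F i)) (m : 'X_{1..n}),
     m \in msupp (diff F i k l) -> (mdeg m + shift l)%N = shift k).

(* Exactness at S/I, at F_0, and at F_(i+1) respectively. *)
Definition resolves (I : S -> Prop) (F : free_complex) : Prop :=
  [/\ forall f : S, exists u : 'rV_(rk F 0), I (f - (u *m aug F) ord0 ord0),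
      forall u : 'rV_(rk F 0),
        I ((u *m aug F) ord0 ord0) <-> exists v, u = v *m diff F 0
    & forall i (u : 'rV_(rk F i.+1)),
        u *m diff F i = 0 <-> exists v, u = v *m diff F i.+1].

Definition minimal_complex (F : free_complex) : Prop :=
  forall i k l, irrelevant_ideal (diff F i k l).

Definition minimal_free_resolution (I : S -> Prop) (F : free_complex) : Prop :=
  [/\ graded_complex F, resolves I F & minimal_complex F].

(* When F is a minimal free resolution of S/I, this is beta_(i,j)(S/I); it does
   not depend on F, minimal free resolutions being unique up to isomorphism. *)
Definition betti (F : free_complex) (i j : nat) : nat :=
  #|[set k : 'I_(rk F i) | shift k == j]|.

Definition linear_for_steps (F : free_complex) (d r : nat) : Prop :=
  forall i j, (1 <= i <= r)%N -> (d <= j)%N -> betti F i (i + j) = 0%N.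

End Resolutions.

(* Main.v *)
Require Import Defs.
From HB Require Import structures.
From mathcomp Require Import all_boot all_order all_algebra.
From mathcomp Require Import mpoly ring zify.
From Stdlib Require Import ClassicalEpsilon.

Set Implicit Arguments.
Unset Strict Implicit.
Unset Printing Implicit Defensive.

Import GRing.Theory.
Local Open Scope ring_scope.

(** The ideal I is zero below degree d and everything above degree d, so the
    only multiplication map in question is S_(d-1) -> (S/I)_d. With
    l = x_1 + ... + x_n this map is onto. Dually
    ([solvable_of_dual_injective]), a function phi on the monomials of degree d
    that vanishes on those in I and satisfies sum_i phi(c x_i) = 0 for every
    monomial c has to be zero. In terms of f = sum_m phi(m) y^m / m! the
    hypothesis says that f is invariant under the diagonal translations.

    Two properties of I give phi = 0: the powers x_i^d lie in I
    ([ideal_pure_power]), and I is sparsely avoided ([sparse_complement]): if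
    x_k does not divide c, then at most one of the monomials c x_i, i <> k, of
    degree d is outside I.

    For phi = 0 ([sparse_functional0]), suppose phi <> 0. By translation
    invariance f is determined by its restriction to y_k = 0 for any k, so phi
    is nonzero at some monomial p x_x^a, where p involves neither x_x nor x_y
    for some fixed x <> y, and a can be taken minimal for these x and y. Some
    x_j divides p, because pure powers lie in I. Minimality and sparsity kill
    all other terms in the relations that move the exponent of x_x over to
    x_y, one unit at a time. They show that phi is nonzero at p x_y^a and at
    (p / x_j) x_y^(a+1): the second value is, up to sign, a + 1 times
    phi(p x_x^a), and this is where characteristic zero enters. These two
    monomials are c x_j and c x_y with c = (p / x_j) x_y^a prime to x_x,
    against sparsity.

    Sparsity is what linearity of the resolution gives at step n - 2. If c x_i
    and c x_j are both outside I, consider c x_i times the exterior product of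
    all e_l with l <> k, i, in the Koszul complex of S/I. It is a cycle because
    I contains all forms of degree d + 1. It is not a boundary: the
    only element of exterior degree n - 1 with its multidegree is c times the
    product of all e_l with l <> k, and the boundary of that one also has the
    nonzero component c x_j. Hence Tor_(n-2)(S/I, K) is
    nonzero in degree n - 2 + d, where linearity forbids it. The passage from
    the Koszul complex to the given resolution F is the usual staircase in the
    double complex ([koszul_chase]). Sparsity concerns three distinct
    indices, so that n - 2 >= 1 whenever there is something to prove. *)

(** * Sparse translation-invariant functionals *)

Lemma mnm_predK n (m : 'X_{1..n}) i : (0 < m i)%N -> (m - U_(i) + U_(i))%MM = m.
Proof. by move=> m_i; apply: submK; rewrite lep1mP -lt0n. Qed.

Lemma mnm_supported n (x : 'I_n) (m : 'X_{1..n}) :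
  (forall i, i != x -> m i = 0%N) -> m = (U_(x) *+ mdeg m)%MM.
Proof.
move=> m0; apply/mnmP=> i; rewrite mulmnE mnm1E mdegE (bigD1 x) //=.
rewrite big1 ?addn0; last by move=> j /m0.
by case: (eqVneq x i) => [<-|xi]; rewrite ?mul1n // m0 1?eq_sym.
Qed.

(** Throughout, [phi] is the functional of the introduction, extended by zero to
    all monomials; [x], [y] and [j] have the roles described there. *)
Section SparseFunctional.
Variables (K : fieldType) (n d : nat) (phi : 'X_{1..n} -> K).
Hypothesis charK : [pchar K] =i pred0.
Hypothesis phi_deg : forall m, phi m != 0 -> mdeg m = d.
Hypothesis phi_ell : forall c, \sum_(i < n) phi (c + U_(i))%MM = 0.
Hypothesis phi_pure : forall i, phi (U_(i) *+ d)%MM = 0.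
Hypothesis phi_sparse : forall (k i j : 'I_n) (c : 'X_{1..n}),
  i != k -> j != k -> i != j -> c k = 0%N ->
  phi (c + U_(i))%MM != 0 -> phi (c + U_(j))%MM = 0.

Lemma phi_move y c :
  phi (c + U_(y))%MM = - \sum_(i < n | i != y) phi (c + U_(i))%MM.
Proof.
by have:= phi_ell c; rewrite (bigD1 y) //= => /eqP; rewrite addr_eq0 => /eqP.
Qed.

Lemma phi_move2 x y c : x != y -> phi (c + U_(y))%MM =
  - phi (c + U_(x))%MM - \sum_(i < n | (i != y) && (i != x)) phi (c + U_(i))%MM.
Proof. by move=> xy; rewrite phi_move (bigD1 x) //= opprD. Qed.

(** A translation-invariant form that vanishes on a hyperplane y_k = 0 is zero:
    the relation trades one factor of the variable [y] for other variables. *)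
Lemma phi_sliceN0 (y : 'I_n) : (forall m : 'X_{1..n}, m y = 0%N -> phi m = 0) ->
  forall m, phi m = 0.
Proof.
move=> H m; move: {2}(m y) (erefl (m y)) => t; elim: t m => [|t IH] m mt; first exact: H.
have m_y : (0 < m y)%N by rewrite mt.
rewrite -(mnm_predK m_y) phi_move big1 ?oppr0 // => i iy; apply: IH.
by rewrite mnmDE mnmBE !mnm1E eqxx (negPf iy) mt addn0 subn1.
Qed.

Section Slice.
Variables (x y : 'I_n) (a : nat).
Hypothesis xy : x != y.
Hypothesis slice0 : forall m : 'X_{1..n}, m y = 0%N -> (m x < a)%N -> phi m = 0.

(** Trading factors of [y] for other variables never raises the total exponent
    of [x] and [y], so the minimality of [a] on the slice where [y] is absent
    propagates to all monomials. *)
Lemma slice_lt (m : 'X_{1..n}) : (m x + m y < a)%N -> phi m = 0.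
Proof.
move: {2}(m y) (erefl (m y)) => t; elim: t m => [|t IH] m mt lt_a.
  by apply: slice0 => //; move: lt_a; rewrite mt addn0.
have m_y : (0 < m y)%N by rewrite mt.
rewrite -(mnm_predK m_y) phi_move big1 ?oppr0 // => i iy; apply: IH.
  by rewrite mnmDE mnmBE !mnm1E eqxx (negPf iy) mt addn0 subn1.
apply: leq_ltn_trans lt_a; rewrite !mnmDE !mnmBE !mnm1E !eqxx (negPf iy).
rewrite (eq_sym y) (negPf xy) subn0 addn0 mt subn1 addnS -addSn leq_add2r.
by rewrite -[leqRHS]addn1 leq_add2l; case: (i == x).
Qed.

(** On the lowest level, where the exponents of [x] and [y] add up to [a], the
    relation has only the two terms that differ in [x] and [y]. *)
Lemma slice_eq (m : 'X_{1..n}) t : m x = 0%N -> m y = 0%N -> (t <= a)%N ->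
  phi (m + U_(x) *+ (a - t) + U_(y) *+ t)%MM = (-1) ^+ t * phi (m + U_(x) *+ a)%MM.
Proof.
move=> mx my; elim: t => [|t IH] lt_ta; first by rewrite expr0 mul1r subn0 addm0.
set c := (m + U_(x) *+ (a - t.+1) + U_(y) *+ t)%MM.
have ->: (m + U_(x) *+ (a - t.+1) + U_(y) *+ t.+1)%MM = (c + U_(y))%MM.
  by apply/mnmP=> i; rewrite /c !mnmDE !mulmnE mulnS; ring.
rewrite (phi_move2 _ xy) big1 => [|i /andP[iy ix]]; last first.
  apply: slice_lt; rewrite /c !mnmDE !mulmnE !mnm1E !eqxx mx my.
  by rewrite (negPf xy) (eq_sym y) (negPf xy) (negPf ix) (negPf iy); lia.
have ->: (c + U_(x))%MM = (m + U_(x) *+ (a - t) + U_(y) *+ t)%MM.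
  by apply/mnmP=> i; rewrite /c !mnmDE !mulmnE -(subnSK lt_ta) mulnS; ring.
by rewrite IH ?(ltnW lt_ta) // exprS mulN1r mulNr subr0.
Qed.

Variables (m : 'X_{1..n}) (j : 'I_n).
Hypothesis (mx : m x = 0%N) (my : m y = 0%N) (jx : j != x) (jy : j != y).
Hypothesis top_neq0 : phi (m + U_(j) + U_(x) *+ a)%MM != 0.

(** One level higher, each relation has, besides the [x] and [y] terms, a single
    further term, the one in [j], because sparsity annihilates the other
    neighbours. By [slice_eq] that term is the same up to sign at every step,
    so the values grow linearly in [t], starting from zero at [t = 0] by
    sparsity again. *)
Lemma slice_succ t : (t <= a.+1)%N ->
  phi (m + U_(x) *+ (a.+1 - t) + U_(y) *+ t)%MM
    = (-1) ^+ t * (t%:R * phi (m + U_(j) + U_(x) *+ a)%MM).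
Proof.
have addjC: (m + U_(j) + U_(x) *+ a = m + U_(x) *+ a + U_(j))%MM.
  by apply/mnmP=> i; rewrite !mnmDE; ring.
have cy: (m + U_(x) *+ a)%MM y = 0%N.
  by rewrite mnmDE mulmnE mnm1E (negPf xy) my.
elim: t => [_|t IH lt_ta].
  rewrite expr0 mul1r mul0r subn0 addm0.
  have ->: (m + U_(x) *+ a.+1)%MM = (m + U_(x) *+ a + U_(x))%MM.
    by apply/mnmP=> i; rewrite !mnmDE !mulmnE mulnS; ring.
  by apply: (phi_sparse jy xy jx cy); rewrite -addjC.
set c := (m + U_(x) *+ (a - t) + U_(y) *+ t)%MM.
have ->: (m + U_(x) *+ (a.+1 - t.+1) + U_(y) *+ t.+1)%MM = (c + U_(y))%MM.
  by apply/mnmP=> i; rewrite /c !mnmDE !mulmnE mulnS subSS; ring.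
have side i : i != x -> i != y ->
    phi (c + U_(i))%MM = (-1) ^+ t * phi (m + U_(i) + U_(x) *+ a)%MM.
  move=> ix iy; rewrite -slice_eq //.
  - by congr phi; apply/mnmP=> k; rewrite /c !mnmDE; ring.
  - by rewrite mnmDE mx mnm1E (negPf ix).
  - by rewrite mnmDE my mnm1E (negPf iy).
rewrite (phi_move2 _ xy) (bigD1 j) /= ?jx ?jy // big1 => [|i]; last first.
  case/andP=> /andP[iy ix] ij; rewrite side //.
  rewrite (_ : (m + U_(i) + U_(x) *+ a = m + U_(x) *+ a + U_(i))%MM).
    by rewrite (phi_sparse jy iy _ cy) ?mulr0 -?addjC // eq_sym.
  by apply/mnmP=> k; rewrite !mnmDE; ring.
rewrite (side j) //.
have ->: (c + U_(x))%MM = (m + U_(x) *+ (a.+1 - t) + U_(y) *+ t)%MM.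
  by apply/mnmP=> i; rewrite /c !mnmDE !mulmnE subSn // mulnS; ring.
by rewrite IH ?(ltnW lt_ta) // exprS -natr1; ring.
Qed.

(** The ends of the two chains, at [t = a] and [t = a.+1], are neighbours that
    avoid [x]. *)
Lemma slice_contra : False.
Proof.
have fact : (-1) ^+ a * phi (m + U_(j) + U_(x) *+ a)%MM != 0.
  by rewrite mulf_neq0 // signr_eq0.
have cx: (m + U_(y) *+ a)%MM x = 0%N.
  by rewrite mnmDE mulmnE mnm1E eq_sym (negPf xy) mx.
have yx : y != x by rewrite eq_sym.
have := phi_sparse jx yx jy cx.
rewrite (_ : (m + U_(y) *+ a + U_(j) = m + U_(j) + U_(x) *+ (a - a) + U_(y) *+ a)%MM);
  last by apply/mnmP=> k; rewrite subnn !mnmDE mulmnE mulmnE; ring.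
rewrite slice_eq //; first 1 last.
- by rewrite mnmDE mx mnm1E (negPf jx).
- by rewrite mnmDE my mnm1E (negPf jy).
move/(_ fact).
rewrite (_ : (m + U_(y) *+ a + U_(y) = m + U_(x) *+ (a.+1 - a.+1) + U_(y) *+ a.+1)%MM);
  last by apply/mnmP=> k; rewrite subnn !mnmDE !mulmnE mulnS; ring.
rewrite slice_succ // => /eqP; apply/negP.
by rewrite !mulf_neq0 ?signr_eq0 // ((pcharf0P K).1 charK).
Qed.

End Slice.

Lemma sparse_functional0 (y : 'I_n) (m : 'X_{1..n}) : phi m = 0.
Proof.
apply: (phi_sliceN0 (y := y)) => {}m my; apply/eqP/negPn/negP => phim.
have [x mx]: exists x, (0 < m x)%N.
  apply/existsP; rewrite -[X in is_true X]negbK negb_exists; apply/negP=> /forallP no_x.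
  have m0 : m = 0%MM.
    by apply/mnmP=> i; rewrite mnm0E; apply/eqP; rewrite -leqn0 leqNgt no_x.
  move: phim (phi_deg phim); rewrite m0 mdeg0 => phim d0.
  by move: (phi_pure y); rewrite -d0 mulm0n => /eqP; rewrite (negPf phim).
have xy : x != y by apply: contraTneq mx => ->; rewrite my.
move=> {mx}; move: {2}(m x) (erefl (m x)) => a.
elim/ltn_ind: a m my phim => a IH m my phim mx.
have slice0 (p : 'X_{1..n}) : p y = 0%N -> (p x < a)%N -> phi p = 0.
  by move=> py px; apply/eqP/negPn/negP => phip; apply: IH px _ _ phip _.
have [j /and3P[jx jy mj]] : exists j, [&& j != x, j != y & (0 < m j)%N].
  apply/existsP; rewrite -[X in is_true X]negbK negb_exists; apply/negP=> /forallP no_j.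
  have mE : m = (U_(x) *+ mdeg m)%MM.
    apply: mnm_supported => i ix; have := no_j i; rewrite ix /=.
    by case: (eqVneq i y) => [->|_] //=; rewrite lt0n negbK => /eqP.
  by move: (phim); rewrite mE (phi_deg phim) phi_pure eqxx.
(* p is m with all of x and one factor of j removed. *)
pose p := [multinom if i == x then 0%N else (m i - (i == j))%N | i < n].
have mE : m = (p + U_(j) + U_(x) *+ a)%MM.
  apply/mnmP=> i; rewrite !mnmDE mulmnE mnmE !mnm1E.
  case: (eqVneq i x) => [->|ix]; first by rewrite (negPf jx) mul1n.
  rewrite mul0n addn0 eq_sym.
  by case: (eqVneq j i) mj => [<-|_] mj; rewrite ?subn0 ?addn0 // subnK.
rewrite mE in phim.
apply: (slice_contra xy slice0 _ _ jx jy phim); rewrite mnmE ?eqxx // eq_sym (negPf xy).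
by rewrite my.
Qed.
End SparseFunctional.

(** * The Koszul complex *)

Section Koszul.
Variable R : comNzRingType.

(** The Koszul complex of a sequence, tensored with a module, as an iterated
    mapping cone: an element over [x :: s] is a pair [(a, b)] standing for
    [a + e_x b], with boundary [(da + x b, - db)]. No signed sums over subsets
    are needed, and every property follows by induction on the sequence. All
    exterior degrees live in one module, and [koszul_deg] singles out the
    homogeneous elements. *)
Fixpoint koszul (M : lmodType R) (s : seq R) : lmodType R :=
  if s is _ :: s' then (koszul M s' * koszul M s')%type : lmodType R else M.
Arguments koszul : simpl never.

Section Operations.
Variable M : lmodType R.
Implicit Types (x : R) (s : seq R).

(** Pairing and projections with folded types, so that simplification never
    exposes the recursion that defines the carrier. *)
Definition kpair x s (a b : koszul M s) : koszul M (x :: s) := (a, b).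
Definition kfst x s (e : koszul M (x :: s)) : koszul M s := e.1.
Definition ksnd x s (e : koszul M (x :: s)) : koszul M s := e.2.
Arguments kpair : simpl never.
Arguments kfst : simpl never.
Arguments ksnd : simpl never.

Lemma kpair_eta x s (e : koszul M (x :: s)) : e = kpair x (kfst e) (ksnd e).
Proof. by case: e. Qed.
Lemma kfst_pair x s (a b : koszul M s) : kfst (kpair x a b) = a. Proof. by []. Qed.
Lemma ksnd_pair x s (a b : koszul M s) : ksnd (kpair x a b) = b. Proof. by []. Qed.
Definition kpairE := (kfst_pair, ksnd_pair).

Lemma kpairP x s c (a b a' b' : koszul M s) :
  c *: kpair x a b + kpair x a' b' = kpair x (c *: a + a') (c *: b + b').
Proof. by []. Qed.

Lemma kfst0 x s : kfst (0 : koszul M (x :: s)) = 0. Proof. by []. Qed.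
Lemma ksnd0 x s : ksnd (0 : koszul M (x :: s)) = 0. Proof. by []. Qed.
Lemma kfstD x s (e e' : koszul M (x :: s)) : kfst (e + e') = kfst e + kfst e'.
Proof. by []. Qed.
Lemma ksndD x s (e e' : koszul M (x :: s)) : ksnd (e + e') = ksnd e + ksnd e'.
Proof. by []. Qed.
Lemma kfstZ x s c (e : koszul M (x :: s)) : kfst (c *: e) = c *: kfst e.
Proof. by []. Qed.
Lemma ksndZ x s c (e : koszul M (x :: s)) : ksnd (c *: e) = c *: ksnd e.
Proof. by []. Qed.
Lemma kfstN x s (e : koszul M (x :: s)) : kfst (- e) = - kfst e. Proof. by []. Qed.
Lemma ksndN x s (e : koszul M (x :: s)) : ksnd (- e) = - ksnd e. Proof. by []. Qed.
Definition klinE := (kfst0, ksnd0, kfstD, ksndD, kfstZ, ksndZ, kfstN, ksndN).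

Fixpoint koszul_diff s : koszul M s -> koszul M s :=
  if s is x :: s' return koszul M s -> koszul M s
  then fun e => kpair x (koszul_diff (kfst e) + x *: ksnd e) (- koszul_diff (ksnd e))
  else fun=> 0.

Fixpoint koszul_deg s (p : nat) : koszul M s -> Prop :=
  if s is x :: s' return koszul M s -> Prop
  then fun e => koszul_deg p (kfst e) /\
         (if p is p'.+1 then koszul_deg p' (ksnd e) else ksnd e = 0)
  else fun e => if p is 0 then True else e = 0.

Fixpoint koszul_all (P : M -> Prop) s : koszul M s -> Prop :=
  if s is x :: s' return koszul M s -> Prop
  then fun e => koszul_all P (kfst e) /\ koszul_all P (ksnd e) else P.

Fixpoint koszul_bot s (m : M) : koszul M s :=
  if s is x :: s' return koszul M s then kpair x (koszul_bot s' m) 0 else m.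

Fixpoint koszul_top s (m : M) : koszul M s :=
  if s is x :: s' return koszul M s then kpair x 0 (koszul_top s' m) else m.

Fixpoint koszul_topc s : koszul M s -> M :=
  if s is x :: s' return koszul M s -> M then fun e => koszul_topc (ksnd e) else id.

Fact koszul_diff_is_linear s : linear (@koszul_diff s).
Proof.
elim: s => [|x s IH] c e e' /=; first by rewrite scaler0 addr0.
rewrite !klinE !IH kpairP; congr kpair.
  by rewrite !scalerDr !scalerA [x * c]mulrC addrACA.
by rewrite opprD scalerN.
Qed.
HB.instance Definition _ s := GRing.isLinear.Build R (koszul M s) (koszul M s) _
  (@koszul_diff s) (@koszul_diff_is_linear s).

Lemma koszul_diff0 s : koszul_diff (0 : koszul M s) = 0.
Proof. exact: (linear0 (@koszul_diff s)). Qed.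
Lemma koszul_diffN s (e : koszul M s) : koszul_diff (- e) = - koszul_diff e.
Proof. exact: (linearN (@koszul_diff s)). Qed.
Lemma koszul_diffDZ s x (e e' : koszul M s) :
  koszul_diff (e + x *: e') = koszul_diff e + x *: koszul_diff e'.
Proof. by rewrite (linearD (@koszul_diff s)) (linearZ_LR (@koszul_diff s)). Qed.

Lemma koszul_diffK s (e : koszul M s) : koszul_diff (koszul_diff e) = 0.
Proof.
elim: s e => [|x s IH] e //=; rewrite !kpairE.
by rewrite koszul_diffDZ koszul_diffN !IH add0r scalerN subrr !oppr0.
Qed.

Lemma koszul_deg0 s p : koszul_deg p (0 : koszul M s).
Proof.
elim: s p => [|x s IH] [|p] //=; rewrite ?klinE; split=> //; exact (IH _).
Qed.

Lemma koszul_degP s p c (e e' : koszul M s) :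
  koszul_deg p e -> koszul_deg p e' -> koszul_deg p (c *: e + e').
Proof.
elim: s p e e' => [|x s IH] [|p] e e' //=; rewrite ?klinE.
- by move=> -> ->; rewrite scaler0 addr0.
- by case=> He -> [He' ->]; split; [apply: IH|rewrite scaler0 addr0].
- by case=> He He2 [He' He'2]; split; apply: IH.
Qed.

Lemma koszul_degZ s p c (e : koszul M s) : koszul_deg p e -> koszul_deg p (c *: e).
Proof.
by move=> He; rewrite -[c *: e]addr0; apply: koszul_degP => //; exact (koszul_deg0 s p).
Qed.

Lemma koszul_degD s p (e e' : koszul M s) :
  koszul_deg p e -> koszul_deg p e' -> koszul_deg p (e + e').
Proof. by rewrite -{2}[e]scale1r; apply: koszul_degP. Qed.

Lemma koszul_degN s p (e : koszul M s) : koszul_deg p e -> koszul_deg p (- e).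
Proof. by rewrite -scaleN1r; apply: koszul_degZ. Qed.

Lemma koszul_diff_deg0 s (e : koszul M s) : koszul_deg 0 e -> koszul_diff e = 0.
Proof.
elim: s e => [|x s IH] e //= [He ->].
by rewrite IH // scaler0 addr0 koszul_diff0 oppr0.
Qed.

Lemma koszul_diff_deg s p (e : koszul M s) :
  koszul_deg p.+1 e -> koszul_deg p (koszul_diff e).
Proof.
elim: s p e => [|x s IH] p e /=; first by case: p.
case=> He1 He2; rewrite !kpairE; split.
  by apply: koszul_degD; [apply: IH|apply: koszul_degZ].
case: p {He1} He2 => [|p] He2; last by apply/koszul_degN/IH.
by rewrite koszul_diff_deg0 // oppr0.
Qed.

Lemma koszul_botP s (e : koszul M s) : koszul_deg 0 e -> exists m, e = koszul_bot s m.
Proof.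
elim: s e => [|x s IH] e; first by exists e.
by case=> /IH[m He1] He2; exists m; rewrite [e]kpair_eta He1 He2.
Qed.

Lemma koszul_bot_linear s c (m m' : M) :
  koszul_bot s (c *: m + m') = c *: koszul_bot s m + koszul_bot s m'.
Proof. by elim: s => //= x s ->; rewrite kpairP scaler0 addr0. Qed.

Lemma koszul_bot0 s : koszul_bot s 0 = 0.
Proof. by elim: s => //= x s ->. Qed.

Lemma koszul_botZ s c m : koszul_bot s (c *: m) = c *: koszul_bot s m.
Proof. by rewrite -[c *: m]addr0 koszul_bot_linear koszul_bot0 addr0. Qed.

Lemma koszul_botB s c (m m' : M) :
  koszul_bot s (m - c *: m') = koszul_bot s m - c *: koszul_bot s m'.
Proof. by rewrite addrC -scaleNr koszul_bot_linear scaleNr addrC. Qed.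

Lemma koszul_bot_deg s m : koszul_deg 0 (koszul_bot s m).
Proof. by elim: s => //= x s IH; rewrite !kpairE. Qed.

Lemma koszul_all_bot (P : M -> Prop) s m : koszul_all P (koszul_bot s m) -> P m.
Proof. by elim: s => //= x s IH [/IH]. Qed.

(** Weak regularity, phrased by means of the complex: [m] belongs to the
    submodule s M exactly when [m] in exterior degree 0 is the boundary of an
    element of degree 1. *)
Fixpoint koszul_regular s : Prop :=
  if s is x :: s' then koszul_regular s' /\
    (forall m (a : koszul M s'), koszul_deg 1 a -> koszul_diff a = koszul_bot s' (x *: m) ->
      exists2 b : koszul M s', koszul_deg 1 b & koszul_diff b = koszul_bot s' m)
  else True.

(** Acyclicity for regular sequences, by the long exact sequence of the cone: if
    the second component of a cycle bounds, correcting the first one by it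
    produces a cycle over the shorter sequence. In exterior degree 0 the second
    component bounds by regularity. *)
Lemma koszul_exact s p (e : koszul M s) : koszul_regular s -> koszul_deg p.+1 e ->
  koszul_diff e = 0 -> exists2 e', koszul_deg p.+2 e' & koszul_diff e' = e.
Proof.
elim: s p e => [|x s IH] p e /=; first by move=> _ ->; exists 0.
rewrite [e]kpair_eta; move: (kfst e) (ksnd e) => {e} a b; rewrite !kpairE.
move=> [reg_s reg_x] [deg_a deg_b] [a_b /eqP].
rewrite oppr_eq0 => /eqP b0.
have [b' deg_b' Db'] : exists2 b', koszul_deg p.+1 b' & koszul_diff b' = b.
  case: p deg_a deg_b => [|p] deg_a deg_b; last exact: IH.
  have [m bm] := koszul_botP deg_b.
  have [] := reg_x m (- a); first exact: koszul_degN.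
    rewrite koszul_diffN koszul_botZ -bm; apply/eqP.
    by rewrite eq_sym -subr_eq0 opprK addrC a_b.
  by move=> b'; rewrite -bm; exists b'.
have [||a' deg_a' Da'] := IH p (a + x *: b') reg_s.
- by apply: koszul_degD => //; apply: koszul_degZ.
- by rewrite koszul_diffDZ Db'.
exists (kpair x a' (- b')); rewrite !kpairE.
  by split=> //; apply: koszul_degN.
by rewrite Da' koszul_diffN Db' opprK scalerN addrK.
Qed.

Fact koszul_topc_is_linear s : linear (@koszul_topc s).
Proof. by elim: s => [|x s IH] c e e' //=; rewrite ?klinE IH. Qed.
HB.instance Definition _ s := GRing.isLinear.Build R (koszul M s) M _
  (@koszul_topc s) (@koszul_topc_is_linear s).

Lemma koszul_topcD s (e e' : koszul M s) :
  koszul_topc (e + e') = koszul_topc e + koszul_topc e'.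
Proof. exact: (linearD (@koszul_topc s)). Qed.
Lemma koszul_topcN s (e : koszul M s) : koszul_topc (- e) = - koszul_topc e.
Proof. exact: (linearN (@koszul_topc s)). Qed.
Lemma koszul_topcZ s x (e : koszul M s) : koszul_topc (x *: e) = x *: koszul_topc e.
Proof. exact: (linearZ_LR (@koszul_topc s)). Qed.
Lemma koszul_topc0 s : koszul_topc (0 : koszul M s) = 0.
Proof. exact: (linear0 (@koszul_topc s)). Qed.

Lemma koszul_topK s : cancel (koszul_top s) (@koszul_topc s).
Proof. by elim: s. Qed.

(** The top exterior power receives no boundary. *)
Lemma koszul_topc_diff s (e : koszul M s) : koszul_topc (koszul_diff e) = 0.
Proof. by elim: s e => [|x s IH] e //=; rewrite kpairE (linearN (@koszul_topc s)) /= IH oppr0. Qed.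

Lemma koszul_top_deg s m : koszul_deg (size s) (koszul_top s m).
Proof. by elim: s => //= x s IH; rewrite !kpairE; split=> //; exact (koszul_deg0 s _). Qed.

Lemma koszul_all0 (P : M -> Prop) s : P 0 -> koszul_all P (0 : koszul M s).
Proof. by move=> P0; elim: s => //= x s IH; rewrite ?klinE. Qed.

Lemma koszul_all_top (P : M -> Prop) s m : P 0 -> P m -> koszul_all P (koszul_top s m).
Proof.
by move=> P0 Pm; elim: s => //= x s IH; rewrite !kpairE; split=> //; exact (koszul_all0 s P0).
Qed.

Lemma koszul_all_sub (P Q : M -> Prop) s (e : koszul M s) :
  (forall m, P m -> Q m) -> koszul_all P e -> koszul_all Q e.
Proof.
by move=> PQ; elim: s e => [|x s IH] e //=; [apply: PQ | case=> ? ?; split; apply: IH].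
Qed.

Lemma koszul_all_and (P Q : M -> Prop) s (e : koszul M s) :
  koszul_all P e -> koszul_all Q e -> koszul_all (fun m => P m /\ Q m) e.
Proof.
by elim: s e => [|x s IH] e //= [? ?] [? ?]; split; apply: IH.
Qed.

Lemma koszul_allD (P : M -> Prop) s (e e' : koszul M s) :
  (forall m m', P m -> P m' -> P (m + m')) ->
  koszul_all P e -> koszul_all P e' -> koszul_all P (e + e').
Proof.
move=> PD; elim: s e e' => [|x s IH] e e' /=; first exact: PD.
by case=> ? ? [? ?]; rewrite !klinE; split; apply: IH.
Qed.

Lemma koszul_allZ (P Q : M -> Prop) s c (e : koszul M s) :
  (forall m, P m -> Q (c *: m)) -> koszul_all P e -> koszul_all Q (c *: e).
Proof.
move=> PQ; elim: s e => [|x s IH] e /=; first exact: PQ.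
by case=> ? ?; rewrite !klinE; split; apply: IH.
Qed.

Lemma koszul_all_diff (P Q : M -> Prop) s (e : koszul M s) :
  Q 0 -> (forall m m', Q m -> Q m' -> Q (m + m')) -> (forall m, Q m -> Q (- m)) ->
  (forall x m, x \in s -> P m -> Q (x *: m)) -> koszul_all P e -> koszul_all Q (koszul_diff e).
Proof.
move=> Q0 QD QN; elim: s e => [|x s IH] e //= PQ [Pa Pb]; rewrite !kpairE.
have PQs y m : y \in s -> P m -> Q (y *: m).
  by move=> ys; apply: PQ; rewrite inE ys orbT.
split.
  apply: koszul_allD => //; first exact: IH PQs Pa.
  by apply: koszul_allZ Pb => m; apply: PQ; rewrite inE eqxx.
rewrite -scaleN1r; apply: koszul_allZ (IH _ PQs Pb) => m Qm.
by rewrite scaleN1r; apply: QN.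
Qed.

End Operations.
Arguments kpair : simpl never.
Arguments kfst : simpl never.
Arguments ksnd : simpl never.

Section Map.
Variables (M N : lmodType R) (f : {linear M -> N}).

Fixpoint koszul_map s : koszul M s -> koszul N s :=
  if s is x :: s' return koszul M s -> koszul N s
  then fun e => kpair x (koszul_map (kfst e)) (koszul_map (ksnd e)) else f.

Fact koszul_map_is_linear s : linear (@koszul_map s).
Proof.
by elim: s => [|x s IH] c e e' /=; [exact: (linearP f)|rewrite !klinE !IH].
Qed.
HB.instance Definition _ s := GRing.isLinear.Build R (koszul M s) (koszul N s) _
  (@koszul_map s) (@koszul_map_is_linear s).

Lemma koszul_map0 s : koszul_map (0 : koszul M s) = 0.
Proof. exact: (linear0 (@koszul_map s)). Qed.
Lemma koszul_mapN s (e : koszul M s) : koszul_map (- e) = - koszul_map e.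
Proof. exact: (linearN (@koszul_map s)). Qed.
Lemma koszul_mapD s (e e' : koszul M s) : koszul_map (e + e') = koszul_map e + koszul_map e'.
Proof. exact: (linearD (@koszul_map s)). Qed.
Lemma koszul_mapDZ s x (e e' : koszul M s) :
  koszul_map (e + x *: e') = koszul_map e + x *: koszul_map e'.
Proof. by rewrite (linearD (@koszul_map s)) (linearZ_LR (@koszul_map s)). Qed.

Lemma koszul_map_diff s (e : koszul M s) :
  koszul_diff (koszul_map e) = koszul_map (koszul_diff e).
Proof.
elim: s e => [|x s IH] e /=; first by rewrite (linear0 f).
by rewrite !kpairE koszul_mapDZ koszul_mapN !IH.
Qed.

Lemma koszul_map_deg s p (e : koszul M s) :
  koszul_deg p e -> koszul_deg p (koszul_map e).
Proof.
elim: s p e => [|x s IH] [|p] e //=; rewrite ?kpairE; first by move=> ->; rewrite (linear0 f).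
  by case=> He ->; rewrite koszul_map0; split=> //; apply: IH.
by case=> He He2; split; apply: IH.
Qed.

Lemma koszul_topc_map s (e : koszul M s) : koszul_topc (koszul_map e) = f (koszul_topc e).
Proof. by elim: s e => [|x s IH] e //=; rewrite kpairE IH. Qed.

(** The predicate [Q] lets the lift be chosen homogeneous in the internal
    grading. *)
Lemma koszul_lift (P : N -> Prop) (Q : M -> Prop) s p (e : koszul N s) :
  Q 0 -> (forall m, P m -> exists2 m', Q m' & m = f m') ->
  koszul_deg p e -> koszul_all P e ->
  exists e', [/\ koszul_deg p e', koszul_all Q e' & e = koszul_map e'].
Proof.
move=> Q0 lift; elim: s p e => [|x s IH] p e /=.
  case: p => [_ /lift[m Qm ->]|p -> _]; first by exists m.
  by exists 0; rewrite (linear0 f).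
rewrite [e]kpair_eta; move: (kfst e) (ksnd e) => {e} a b; rewrite !kpairE.
case=> deg_a deg_b [Pa Pb].
have [b' [? ? ->]] : exists b', [/\ if p is p'.+1 then koszul_deg p' b' else b' = 0,
    koszul_all Q b' & b = koszul_map b'].
  case: p {deg_a} deg_b => [->|p deg_b]; last exact: IH.
  by exists 0; rewrite koszul_map0; split=> //; exact (koszul_all0 s Q0).
have [a' [? ? ->]] := IH p a deg_a Pa.
by exists (kpair x a' b'); rewrite !kpairE.
Qed.

Lemma koszul_map_eq0 s (e : koszul M s) :
  koszul_map e = 0 -> koszul_all (fun m => f m = 0) e.
Proof.
elim: s e => [|x s IH] e //= e0; split; apply: IH.
  by rewrite -[LHS]/(kfst (kpair x _ (koszul_map (ksnd e)))) e0 klinE.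
by rewrite -[LHS]/(ksnd (kpair x (koszul_map (kfst e)) _)) e0 klinE.
Qed.
End Map.

Lemma koszul_map_comp0 (L M N : lmodType R) (g : {linear L -> M}) (f : {linear M -> N})
    s (e : koszul L s) : (forall u, f (g u) = 0) -> koszul_map f (koszul_map g e) = 0.
Proof. by move=> fg0; elim: s e => [|x s IH] e //=; rewrite !kpairE !IH. Qed.
End Koszul.

(** * Koszul complexes of variables and graded free modules *)

Section Monomials.
Variables (n : nat) (K : fieldType).
Implicit Types (f g : {mpoly K[n]}) (m : 'X_{1..n}) (i : 'I_n).

Definition mpoly_restrict (P : pred 'X_{1..n}) f : {mpoly K[n]} :=
  \sum_(m <- msupp f | P m) f@_m *: 'X_[m].

Lemma mcoeff_restrict P f m : (mpoly_restrict P f)@_m = if P m then f@_m else 0.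
Proof.
rewrite raddf_sum /=; under eq_bigr do rewrite mcoeffZ mcoeffX.
have [m_f|mNf] := boolP (m \in msupp f).
  rewrite big_mkcond (bigD1_seq m) ?msupp_uniq //= big1 ?addr0.
    by rewrite eqxx mulr1.
  by move=> m' /negPf->; rewrite mulr0 if_same.
rewrite (memN_msupp_eq0 mNf) if_same big1_seq // => m' /andP[_ m'_f].
by case: eqP m'_f mNf => [-> -> //|_ _ _]; rewrite mulr0.
Qed.

Lemma mcoeffXM i f m :
  ('X_i * f)@_m = if m i == 0%N then 0 else f@_(m - U_(i))%MM.
Proof.
case: eqP => [mi0|/eqP mi]; last first.
  have {1}-> : m = (U_(i) + (m - U_(i)))%MM.
    by rewrite addmC submK // lep1mP.
  by rewrite mulrC mcoeffMX.
rewrite (mpolyE f) mulr_sumr raddf_sum big1_seq // => m' _ /=.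
rewrite -scalerAr mcoeffZ -mpolyXD mcoeffX; case: eqP => [mE|]; last by rewrite mulr0.
by move: mi0; rewrite -mE mnmDE mnm1E eqxx.
Qed.

Lemma mpoly_divX i f : exists g, f = 'X_i * g + mpoly_restrict (fun m => m i == 0%N) f.
Proof.
exists (\sum_(m <- msupp f | m i != 0%N) f@_m *: 'X_[m - U_(i)]).
rewrite {1}(mpolyE f) (bigID (fun m => m i == 0%N)) /= addrC; congr (_ + _).
rewrite mulr_sumr; apply: eq_bigr => m mi; rewrite -scalerAr -mpolyXD.
by rewrite addmC submK // lep1mP.
Qed.

End Monomials.

Section VariablesRegular.
Variables (n r : nat) (K : fieldType).
Local Notation S := {mpoly K[n]}.
Local Notation vars := (map (fun i : 'I_n => 'X_i : S)).

Definition in_vars_ideal (idx : seq 'I_n) (u : 'rV[S]_r) :=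
  forall k (m : 'X_{1..n}), (forall i, i \in idx -> m i = 0%N) -> (u ord0 k)@_m = 0.

(** The boundaries in exterior degree 0 are the vectors with entries in the ideal
    of the variables of [idx], which is a condition on the monomials that occur.
    Conversely, such a vector is a multiple of the first variable plus a vector
    in which that variable is absent, and induction applies to the latter. *)
Lemma koszul_image1 idx (u : 'rV[S]_r) :
  (exists2 a : koszul 'rV[S]_r (vars idx), koszul_deg 1 a & koszul_diff a = koszul_bot _ u)
  <-> in_vars_ideal idx u.
Proof.
elim: idx u => [|i idx IH] u /=; split.
- by case=> a _ <- k m _; rewrite mxE mcoeff0.
- move=> u0; exists 0 => //; apply/rowP=> k; apply/mpolyP=> m.
  by rewrite u0 // mxE mcoeff0.
- case=> a [deg_a /koszul_botP[u' a2E]] aE.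
  have := congr1 (@kfst _ _ _ _) aE; rewrite !kpairE a2E => /(canRL (addrK _)).
  rewrite -koszul_botB => /(ex_intro2 _ _ _ deg_a)/IH vu k m m0.
  have := vu k m (fun l lidx => m0 l (mem_behead (s := i :: idx) lidx)).
  rewrite !mxE mcoeffB mcoeffXM m0 ?mem_head //= subr0 => <- //.
- move=> vu.
  pose u1 : 'rV[S]_r := \row_k mpoly_restrict (fun m => m i == 0%N) (u ord0 k).
  have [u2 uE] : exists u2 : 'rV[S]_r, u = 'X_i *: u2 + u1.
    have /fin_all_exists[g gE] := fun k => mpoly_divX i (u ord0 k).
    by exists (\row_k g k); apply/rowP=> k; rewrite !mxE {1}gE.
  have [|a deg_a aE] := (IH u1).2.
    move=> k m m0; rewrite mxE mcoeff_restrict; case: eqP => // mi.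
    by apply: vu => l; rewrite inE => /predU1P[->|/m0].
  exists (kpair ('X_i : S) a (koszul_bot _ u2)); rewrite !kpairE.
    by split=> //; apply: koszul_bot_deg.
  rewrite aE koszul_diff_deg0 ?oppr0; last exact: koszul_bot_deg.
  congr kpair.
  have -> : u1 = u - 'X_i *: u2 by rewrite uE addrAC subrr add0r.
  by rewrite koszul_botB uE subrK.
Qed.

Lemma koszul_vars_regular idx : uniq idx -> koszul_regular 'rV[S]_r (vars idx).
Proof.
elim: idx => //= i idx IH /andP[i_idx uniq_idx]; split; first exact: IH.
move=> u a deg_a aE; apply/koszul_image1 => k m m0.
have /koszul_image1/(_ k (m + U_(i))%MM) :
    exists2 a, koszul_deg 1 a & koszul_diff a = koszul_bot (vars idx) ('X_i *: u).
  by exists a.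
rewrite mxE mcoeffXM mnmDE mnm1E eqxx addn1 addmK; apply=> l lidx.
rewrite mnmDE mnm1E m0 //; case: eqP => // li.
by rewrite li lidx in i_idx.
Qed.

End VariablesRegular.

Section Graded.
Variables (n : nat) (K : fieldType).
Local Notation S := {mpoly K[n]}.

(** For [P := eq e] these are the homogeneous elements of degree [e] of the free
    module with the given shifts; a general [P] also covers the elements without
    component of degree [e]. *)
Definition graded_supp (P : nat -> Prop) r (sh : 'I_r -> nat) (u : 'rV[S]_r) :=
  forall k m, m \in msupp (u ord0 k) -> P (mdeg m + sh k)%N.

Lemma graded_supp0 P r (sh : 'I_r -> nat) : graded_supp P sh 0.
Proof. by move=> k m; rewrite mxE msupp0. Qed.

Lemma graded_suppD P r (sh : 'I_r -> nat) u v :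
  graded_supp P sh u -> graded_supp P sh v -> graded_supp P sh (u + v).
Proof. by move=> Pu Pv k m; rewrite mxE => /msuppD_le; rewrite mem_cat => /orP[/Pu|/Pv]. Qed.

Lemma graded_suppN P r (sh : 'I_r -> nat) u : graded_supp P sh u -> graded_supp P sh (- u).
Proof. by move=> Pu k m; rewrite mxE (perm_mem (msuppN _)) => /Pu. Qed.

Lemma graded_suppX e r (sh : 'I_r -> nat) u i :
  graded_supp (eq e) sh u -> graded_supp (eq e.+1) sh ('X_i *: u).
Proof.
move=> Pu k m; rewrite mxE mcoeff_msupp mcoeffXM.
case: (eqVneq (m i) 0%N) => [_|mi]; first by rewrite eqxx.
rewrite -mcoeff_msupp => /Pu ->; rewrite -addSn; congr (_ + _)%N.
by rewrite -addn1 -(mdeg1 i) -mdegD submK // lep1mP.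
Qed.

Lemma graded_supp_split e r (sh : 'I_r -> nat) (u : 'rV[S]_r) :
  exists u1 u2, [/\ u = u1 + u2, graded_supp (eq e) sh u1 &
    graded_supp (fun e' => e <> e') sh u2].
Proof.
exists (\row_k mpoly_restrict (fun m => e == mdeg m + sh k)%N (u ord0 k)).
exists (\row_k mpoly_restrict (fun m => e != mdeg m + sh k)%N (u ord0 k)).
split.
- apply/rowP=> k; apply/mpolyP=> m; rewrite !mxE mcoeffD !mcoeff_restrict.
  by case: eqP => _ /=; rewrite ?addr0 ?add0r [ord0]ord1.
- by move=> k m; rewrite mxE mcoeff_msupp mcoeff_restrict; case: (eqVneq e) => //=; rewrite eqxx.
- move=> k m; rewrite mxE mcoeff_msupp mcoeff_restrict.
  by case: (eqVneq e) => [|/eqP //] /=; rewrite eqxx.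
Qed.

Lemma graded_supp_disjoint (P Q : nat -> Prop) r (sh : 'I_r -> nat) u :
  (forall e, P e -> Q e -> False) ->
  graded_supp P sh u -> graded_supp Q sh u -> u = 0.
Proof.
move=> PQ Pu Qu; apply/rowP=> k; apply/mpolyP=> m; rewrite mxE mcoeff0.
by apply: memN_msupp_eq0; apply/negP=> mu; apply: PQ (Pu _ _ mu) (Qu _ _ mu).
Qed.

Section Matrix.
Variables (r r' : nat) (sh : 'I_r -> nat) (sh' : 'I_r' -> nat) (D : 'M[S]_(r, r')).
Hypothesis D_graded : forall k l m, m \in msupp (D k l) -> (mdeg m + sh' l = sh k)%N.

Lemma graded_supp_mulmx P u : graded_supp P sh u -> graded_supp P sh' (u *m D).
Proof.
move=> Pu l m; rewrite mxE => /msupp_sum_le/flattenP[_ /mapP[k _ ->]].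
move=> /msuppM_le/allpairsP[[m1 m2] /= [m1u m2D ->]].
by rewrite mdegD -addnA (D_graded m2D); apply: Pu.
Qed.

(** The component of degree [e] of any preimage is again a preimage: the other
    components map to something that is homogeneous of degree [e] and has no
    component of that degree. *)
Lemma graded_lift e u v : u = v *m D -> graded_supp (eq e) sh' u ->
  exists2 v', graded_supp (eq e) sh v' & u = v' *m D.
Proof.
have [v1 [v2 [-> ev1 Nv2]]] := graded_supp_split e sh v.
rewrite mulmxDl => uE eu.
exists v1 => //; apply/eqP; rewrite -subr_eq0; apply/eqP.
have uv2 : u - v1 *m D = v2 *m D by rewrite uE addrAC subrr add0r.
apply: (@graded_supp_disjoint (eq e) (fun e' => e <> e') _ sh').
- by [].
- by apply: graded_suppD; [|apply: graded_suppN; exact: graded_supp_mulmx].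
- rewrite uv2; exact: graded_supp_mulmx.
Qed.
End Matrix.
End Graded.

(** * From the resolution to Koszul homology *)

Section Chase.
Variables (n : nat) (K : fieldType) (I : {mpoly K[n]} -> Prop) (F : free_complex n K).
Local Notation S := {mpoly K[n]}.
Local Notation vars := (map (fun i : 'I_n => 'X_i : S)).
Local Notation d_ q := (mulmxr (diff F q)).
Hypothesis F_res : minimal_free_resolution I F.
Variables (idx : seq 'I_n) (d r : nat).
Hypotheses (idx_uniq : uniq idx) (idx_full : forall i, i \in idx).
Hypothesis shift_lt : forall k : 'I_(rk F r), (shift k < d + r)%N.

(** The staircase in the double complex of the Koszul complex and [F]. The
    boundary of [z] lifts along [F] to an element one step lower, still with
    components in degree [d + q]. At the bottom an element of [F_r] of degree
    [d + r] is reached; all generators of [F_r] have smaller degree, so its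
    entries lie in the irrelevant ideal and it is a Koszul boundary. Going up,
    each remaining error is a Koszul cycle of positive degree over a free
    module, hence a boundary. *)
Lemma koszul_chase p q (z : koszul 'rV[S]_(rk F q) (vars idx)) : (p + q = r)%N ->
  koszul_deg p z -> koszul_all (graded_supp (eq (d + q)%N) (@shift _ _ F q)) z ->
  koszul_all (fun u => exists v, u = v *m diff F q) (koszul_diff z) ->
  exists w y, koszul_deg p.+1 w /\ z = koszul_diff w + koszul_map (d_ q) y.
Proof.
case: F_res => [[_ gr_diff] [_ _ exF] _].
elim: p q z => [|p IH] q z.
  rewrite add0n => qr; have shift_ltq : forall k : 'I_(rk F q), (shift k < d + q)%N by rewrite qr.
  move=> /koszul_botP[u ->] /koszul_all_bot eu _.
  have [k m m0|w deg_w Dw] := (koszul_image1 idx u).2.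
    have {}m0 : m = 0%MM by apply/mnmP=> i; rewrite m0 ?mnm0E.
    apply: memN_msupp_eq0; apply/negP=> /eu/=; rewrite m0 mdeg0 add0n => dE.
    by have := shift_ltq k; rewrite -dE ltnn.
  by exists w, 0; rewrite koszul_map0 addr0 Dw.
move=> pq deg_z ez imz.
have [z' [deg_z' ez' Dz]] : exists z', [/\ koszul_deg p z',
    koszul_all (graded_supp (eq (d + q.+1)%N) (@shift _ _ F q.+1)) z' &
    koszul_diff z = koszul_map (d_ q) z'].
  pose P (u : 'rV[S]_(rk F q)) := graded_supp (eq (d + q.+1)%N) (@shift _ _ F q) u /\
    exists v, u = v *m diff F q.
  apply: (koszul_lift (P := P)).
  - exact: graded_supp0.
  - by move=> u [eu [v uE]]; apply: (graded_lift (@gr_diff q) uE eu).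
  - exact: koszul_diff_deg.
  - apply: koszul_all_and => //; apply: koszul_all_diff ez.
    + exact: graded_supp0.
    + by move=> u v; apply: graded_suppD.
    + by move=> u; apply: graded_suppN.
    + by move=> _ u /mapP[i _ ->]; rewrite addnS; apply: graded_suppX.
have imz' : koszul_all (fun u => exists v, u = v *m diff F q.+1) (koszul_diff z').
  have := koszul_map_eq0 (f := d_ q) (e := koszul_diff z').
  rewrite -koszul_map_diff -Dz koszul_diffK => /(_ erefl).
  by apply: koszul_all_sub => u; apply: (exF q u).1.
have [|w' [y' [deg_w' z'E]]] := IH q.+1 z' _ deg_z' ez' imz'; first by rewrite addnS.
have [||w deg_w Dw] := koszul_exact (p := p) (e := z - koszul_map (d_ q) w')
    (koszul_vars_regular _ K idx_uniq).
- apply: koszul_degD => //; apply: koszul_degN; exact: koszul_map_deg.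
- rewrite -scaleN1r koszul_diffDZ scaleN1r koszul_map_diff Dz z'E.
  rewrite koszul_mapD addrAC subrr add0r.
  by apply: koszul_map_comp0 => u; apply: (exF q (u *m diff F q.+1)).2; exists u.
by exists w, w'; rewrite Dw subrK.
Qed.
End Chase.

(** * Monomial ideals *)

Section MonomialIdeals.
Variables (n : nat) (K : fieldType) (I : {mpoly K[n]} -> Prop).
Implicit Types (f g h : {mpoly K[n]}) (m c : 'X_{1..n}).
Hypothesis I_monomial : monomial_ideal I.

Lemma ideal0 : I 0.
Proof. by case: I_monomial => M IE; apply/IE; exists [::]; rewrite ?big_nil. Qed.

Lemma idealD f g : I f -> I g -> I (f + g).
Proof.
case: I_monomial => M IE /IE[s1 Ms1 ->] /IE[s2 Ms2 ->]; apply/IE.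
exists (s1 ++ s2); last by rewrite big_cat.
by move=> x; rewrite mem_cat => /orP[/Ms1|/Ms2].
Qed.

Lemma idealM f g : I f -> I (g * f).
Proof.
case: I_monomial => M IE /IE[s Ms ->]; apply/IE.
exists [seq (g * x.1, x.2) | x <- s]; first by move=> _ /mapP[x /Ms Mx ->].
by rewrite big_map mulr_sumr; apply: eq_bigr => x _; rewrite mulrA.
Qed.

Lemma monomial_idealP f : I f <-> forall m, m \in msupp f -> I 'X_[m].
Proof.
split=> [|If].
  case: I_monomial => M IE /IE[s Ms ->] m /msupp_sum_le/flattenP[_ /mapP[x xs ->]].
  have {}xs : x \in s by move: xs; rewrite mem_filter.
  have [m0 Mm0 ->] := Ms x xs.
  move=> /msuppM_le/allpairsP[[m1 m2] /= [_]].
  rewrite msuppX inE => /eqP -> ->; rewrite mpolyXD; apply: idealM; apply/IE.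
  exists [:: (1, 'X_[m0])]; last by rewrite big_seq1 mul1r.
  by move=> y; rewrite inE => /eqP->; exists m0.
rewrite (mpolyE f) big_seq; apply: (big_ind I); [exact: ideal0|exact: idealD|].
by move=> m /If Im; rewrite -mul_mpolyC; apply: idealM.
Qed.

Lemma minimal_generator_below m : I 'X_[m] ->
  exists2 m', minimal_generator I m' & (m' <= m)%MM.
Proof.
move: {2}(mdeg m) (leqnn (mdeg m)) => k; elim: k m => [|k IH] m mk Im.
  exists m; last exact: lepm_refl.
  split=> // m' m'm _; apply/mnmP=> i.
  have m0 : m = 0%MM by apply/eqP; rewrite -mdeg_eq0 -leqn0.
  by move/mnm_lepP: m'm => /(_ i); rewrite m0 mnm0E leqn0 => /eqP ->.
case: (classic (minimal_generator I m)) => [min_m|Nmin_m].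
  by exists m; last exact: lepm_refl.
have [m' [m'm Im' m'Nm]] : exists m', [/\ (m' <= m)%MM, I 'X_[m'] & m' <> m].
  apply: NNPP => H; apply: Nmin_m; split=> // m' m'm Im'.
  by apply: NNPP => m'Nm; apply: H; exists m'.
have [|m2 min_m2 m2m'] := IH m' _ Im'; last by exists m2 => //; apply: lepm_trans m'm.
rewrite -ltnS; apply: leq_trans mk; rewrite -(submK m'm) mdegD -[ltnLHS]add0n ltn_add2r.
rewrite lt0n mdeg_eq0; apply: contra_notN m'Nm => /eqP mm'.
by rewrite -[RHS](submK m'm) mm' add0m.
Qed.

Variable d : nat.
Hypothesis I_degree : generated_in_degree I d.

Lemma ideal_mdeg_ge m : I 'X_[m] -> (d <= mdeg m)%N.
Proof.
case/minimal_generator_below => m' /I_degree <- m'm.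
by rewrite -(submK m'm) mdegD leq_addl.
Qed.

Hypothesis I_power : forall f : {mpoly K[n]},
  ideal_exp (@irrelevant_ideal n K) d.+1 f -> I f.

Lemma monomial_in_power k m : (k <= mdeg m)%N -> ideal_exp (@irrelevant_ideal n K) k 'X_[m].
Proof.
elim: k m => [|k IH] m //= km.
have [i mi] : exists i, (0 < m i)%N.
  apply/existsP; rewrite -[X in is_true X]negbK negb_exists; apply/negP=> /forallP no_i.
  by move: km; rewrite mdegE big1 // => i _; apply/eqP; rewrite -leqn0 leqNgt no_i.
have mE := mnm_predK mi; exists [:: (1, 'X_[m])]; last by rewrite big_seq1 mul1r.
move=> x; rewrite inE => /eqP-> /=; exists 'X_i, 'X_[m - U_(i)]; split.
- exists [:: (1, 'X_i)]; last by rewrite big_seq1 mul1r.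
  by move=> y; rewrite inE => /eqP->; exists i.
- by apply: IH; move: km; rewrite -{1}mE mdegD mdeg1 addn1.
- by rewrite -mpolyXD addmC mE.
Qed.

Lemma ideal_mdeg_gt m : (d < mdeg m)%N -> I 'X_[m].
Proof. by move=> dm; apply/I_power/monomial_in_power. Qed.

Lemma ideal_pure_power i : I 'X_[U_(i) *+ d].
Proof.
have : I 'X_[U_(i) *+ d.+1] by apply: ideal_mdeg_gt; rewrite mdegMn mdeg1 mul1n.
case/minimal_generator_below=> m min_m /mnm_lepP le_m.
have mE : m = (U_(i) *+ mdeg m)%MM.
  apply: mnm_supported => j ji; have := le_m j.
  by rewrite mulmnE mnm1E eq_sym (negPf ji) mul0n leqn0 => /eqP.
by case: min_m (I_degree min_m) => Im _ <-; rewrite -mE.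
Qed.

Section Sparse.
Variable F : free_complex n K.
Hypothesis F_resolution : minimal_free_resolution I F.
Hypothesis F_linear : linear_for_steps F d (n - 2).

Local Notation ev u := ((u *m aug F) ord0 ord0).

Lemma aug_graded k (l : 'I_1) m :
  m \in msupp (aug F k l) -> (mdeg m + (fun _ : 'I_1 => 0%N) l)%N = shift k.
Proof.
case: F_resolution => [[gr_aug _] _ _].
by rewrite ord1 addn0 => mF; apply: (dhomogP _ _ _ (gr_aug k)).
Qed.

Lemma ev_graded P u m : graded_supp P (@shift _ _ F 0) u -> m \in msupp (ev u) -> P (mdeg m).
Proof.
by move=> /(graded_supp_mulmx aug_graded) Pu /Pu; rewrite addn0.
Qed.

(** A preimage in [F_0] exists by exactness; its component of degree [d] will
    do, since a monomial ideal is homogeneous. *)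
Lemma graded_lift_monomial m : mdeg m = d ->
  exists2 u, graded_supp (eq d) (@shift _ _ F 0) u & I ('X_[m] - ev u).
Proof.
case: (F_resolution) => [_ [surj _ _] _] md.
have [u Iu] := surj 'X_[m].
have [u1 [u2 [uE du1 Nu2]]] := graded_supp_split d (@shift _ _ F 0) u.
exists u1 => //; apply/monomial_idealP => m' m'_f.
have dm' : d = mdeg m'.
  move/msuppB_le: m'_f; rewrite mem_cat msuppX inE => /orP[/eqP -> //|].
  exact: (@ev_graded (eq d)).
apply: (monomial_idealP _).1 Iu _ _; move: m'_f; rewrite !mcoeff_msupp.
have -> : ev u = ev u1 + ev u2 by rewrite uE mulmxDl [LHS]mxE.
rewrite opprD addrA [X in _ -> X != 0]mcoeffB.
have -> : (ev u2)@_m' = 0.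
  apply: memN_msupp_eq0; apply/negP=> m'u.
  exact: (@ev_graded (fun e => d <> e) _ _ Nu2 m'u).
by rewrite subr0.
Qed.

Lemma shift_linear : (1 <= n - 2)%N ->
  forall k : 'I_(rk F (n - 2)), (shift k < d + (n - 2))%N.
Proof.
move=> n2 k; rewrite ltnNge; apply/negP=> le_k.
have := F_linear (i := (n - 2)%N) (j := (shift k - (n - 2))%N).
rewrite n2 leqnn => /(_ erefl); have le2 : (n - 2 <= shift k)%N.
  by apply: leq_trans le_k; rewrite leq_addl.
rewrite leq_subRL // addnC le_k subnKC // => /(_ erefl) /eqP.
by rewrite cards_eq0 => /eqP/setP/(_ k); rewrite !inE eqxx.
Qed.

(** The Koszul complex is built over the sequence x_k, x_i, x_j, followed by the
    other variables, so that the components that matter are outermost. Writing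
    the cycle [z] as a boundary modulo I and comparing components gives, with
    v the image in S of the coefficient at the product of all e_l, l <> k:
    c x_i = x_i v modulo I + (x_k), and x_j v = 0 modulo I + (x_k). As c x_i and
    c x_j are outside the monomial ideal I and prime to x_k, the coefficient of
    c in v is both 1 and 0. *)
Lemma sparse_complement (k i j : 'I_n) c :
  i != k -> j != k -> i != j -> c k = 0%N ->
  mdeg (c + U_(i))%MM = d -> ~ I 'X_[c + U_(i)] -> I 'X_[c + U_(j)].
Proof.
move=> ik jk ij ck cd NIi; apply: NNPP => NIj.
pose rest := [seq l <- enum 'I_n | l \notin [:: k; i; j]].
pose idx := k :: i :: j :: rest.
pose t : seq {mpoly K[n]} := [seq 'X_l | l <- j :: rest].
have idx_uniq : uniq idx.
  rewrite /= filter_uniq ?enum_uniq // !inE !mem_filter !inE !eqxx !orbT /=.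
  by rewrite !(eq_sym k) (negPf ik) (negPf jk) (negPf ij).
have idx_full l : l \in idx.
  by rewrite !inE mem_filter !inE mem_enum andbT; do 3!case: eqP => //=.
have sz : size idx = n.
  rewrite -[RHS]size_enum_ord; apply: perm_size; apply: uniq_perm => //; first exact: enum_uniq.
  by move=> l; rewrite idx_full mem_enum.
have szt : size t = (n - 2)%N by have := sz; rewrite size_map /=; lia.
have n2 : (1 <= n - 2)%N by rewrite -szt.
have [u du Iu] := graded_lift_monomial cd.
pose z : koszul 'rV[{mpoly K[n]}]_(rk F 0) [seq 'X_l | l <- idx] :=
  kpair 'X_k (kpair 'X_i (koszul_top t u) 0) 0.
have dz : koszul_all (graded_supp (eq d) (@shift _ _ F 0)) z.
  have g0 := @graded_supp0 n K (eq d) _ (@shift _ _ F 0).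
  split; [split|]; rewrite ?kpairE.
  + exact: koszul_all_top.
  + exact (koszul_all0 _ g0).
  + exact (koszul_all0 _ g0).
have [||||w [y [_ zE]]] := koszul_chase F_resolution idx_uniq idx_full (shift_linear n2)
    (p := size t) (q := 0) (z := z).
- by rewrite addn0.
- split; [split|].
  + exact (koszul_top_deg t u).
  + exact (koszul_deg0 _ _ _).
  + exact (koszul_deg0 _ _ _).
- by rewrite addn0.
- have exI (u' : 'rV_(rk F 0)) : graded_supp (eq d.+1) (@shift _ _ F 0) u' ->
      exists v, u' = v *m diff F 0.
    move=> du'; case: F_resolution => [_ [_ /(_ u') [exF _] _] _]; apply: exF.
    by apply/monomial_idealP => m /(ev_graded du') dm; apply: ideal_mdeg_gt; rewrite -dm.
  apply: koszul_all_sub exI _; apply: koszul_all_diff dz.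
  + exact: graded_supp0.
  + by move=> u1 u2; apply: graded_suppD.
  + by move=> u1; apply: graded_suppN.
  + by move=> _ u1 /mapP[l _ ->]; apply: graded_suppX.
(* uE and vE compare the components of zE at the product of the e_l with l in
   j :: rest, and with l in i :: rest. *)
pose v := koszul_topc (ksnd (kfst w)).
have [v1 [y1 uE]] : exists v1 y1, u = 'X_i *: v + 'X_k *: v1 + y1 *m diff F 0.
  exists (koszul_topc (kfst (ksnd w))), (koszul_topc (kfst (kfst y))).
  have := congr1 (fun e => koszul_topc (kfst (kfst e))) zE; rewrite /z /=.
  rewrite koszul_topK !koszul_topcD koszul_topcN !koszul_topcZ koszul_topc_map koszul_topc_diff.
  by rewrite oppr0 add0r => uE; exact uE.
have [v2 [y2 vE]] : exists v2 y2, 'X_j *: v = 'X_k *: v2 + y2 *m diff F 0.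
  exists (koszul_topc (kfst (ksnd (ksnd w)))), (koszul_topc (kfst (ksnd (kfst y)))).
  have := congr1 (fun e => koszul_topc (kfst (ksnd (kfst e)))) zE; rewrite /z /=.
  rewrite koszul_topc0 !koszul_topcD koszul_topcN !koszul_topcD !koszul_topcZ koszul_topc_map.
  rewrite koszul_topc_diff add0r => /esym/eqP.
  by rewrite -addrA addrC subr_eq0 => /eqP vE; exact (esym vE).
have evI (y' : 'rV_(rk F 1)) : I (ev (y' *m diff F 0)).
  by case: F_resolution => [_ [_ /(_ (y' *m diff F 0)) [_ imI] _] _]; apply: imI; exists y'.
have evD (u1 u2 : 'rV_(rk F 0)) : ev (u1 + u2) = ev u1 + ev u2 by rewrite mulmxDl [LHS]mxE.
have evZ x (u1 : 'rV_(rk F 0)) : ev (x *: u1) = x * ev u1 by rewrite -scalemxAl [LHS]mxE.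
have coef0 f m : I f -> ~ I 'X_[m] -> f@_m = 0.
  move=> /monomial_idealP If NIm; apply: memN_msupp_eq0; apply/negP=> mf.
  exact/NIm/If.
have v_c1 : (ev v)@_c = 1.
  have Iu' : I ('X_[c + U_(i)] - 'X_i * ev v - 'X_k * ev v1).
    have := idealD Iu (evI y1); rewrite uE !evD !evZ; congr I; ring.
  have := coef0 _ _ Iu' NIi; rewrite !mcoeffB mcoeffX eqxx !mcoeffXM !mnmDE !mnm1E eqxx ck.
  by rewrite (negPf ik) addn1 addmK subr0 => /eqP; rewrite subr_eq0 => /eqP.
have v_c0 : (ev v)@_c = 0.
  have Iv : I ('X_j * ev v - 'X_k * ev v2).
    have := evI y2; rewrite -(evZ 'X_j) vE !evD !evZ; congr I; ring.
  have := coef0 _ _ Iv NIj; rewrite mcoeffB !mcoeffXM !mnmDE !mnm1E eqxx ck.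
  by rewrite (negPf jk) addn1 addmK subr0.
by move: v_c1; rewrite v_c0 => /esym/eqP; rewrite oner_eq0.
Qed.
End Sparse.
End MonomialIdeals.

(** * Surjectivity in degree d by duality *)

(** A vector lies in the row space of a matrix as soon as every linear form that
    vanishes on the rows vanishes on it. The predicate restricts the equations
    to the coordinates of interest. *)
Lemma solvable_of_dual_injective (K : fieldType) (T U : finType) (P : pred U)
    (B : T -> U -> K) :
  (forall phi : U -> K, (forall t, \sum_(u | P u) B t u * phi u = 0) ->
     forall u, P u -> phi u = 0) ->
  forall g : U -> K, exists v : T -> K, forall u, P u -> g u = \sum_t v t * B t u.
Proof.
move=> inj g.
pose mask (x : K) u := if P u then x else 0.
pose M : 'M[K]_(#|T|, #|U|) := \matrix_(t, u) mask (B (enum_val t) (enum_val u)) (enum_val u).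
pose G : 'rV[K]_#|U| := \row_u mask (g (enum_val u)) (enum_val u).
have [D GE] : exists D, G = D *m M.
  apply/submxP; rewrite submxE; apply/eqP/rowP=> l; rewrite [RHS]mxE mxE big1 // => u _.
  rewrite mxE /mask; case: ifP => Pu; last by rewrite mul0r.
  suff : cokermx M (enum_rank (enum_val u)) l = 0 by rewrite enum_valK => ->; rewrite mulr0.
  apply: (inj (fun u => cokermx M (enum_rank u) l)) Pu => t.
  have := congr1 (fun A : 'M_(_, _) => A (enum_rank t) l) (mulmx_coker M).
  rewrite [RHS]mxE mxE => MC0; apply: etrans MC0;
  rewrite [LHS]big_mkcond (reindex_onto enum_val enum_rank) /=; last first.
    by move=> w _; rewrite enum_rankK.
  apply: eq_big => [w|w _]; first by rewrite enum_valK eqxx.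
  by rewrite [M _ _]mxE enum_rankK enum_valK /mask; case: ifP; rewrite ?mul0r.
exists (fun t => D ord0 (enum_rank t)) => u Pu.
have := congr1 (fun A : 'M_(_, _) => A ord0 (enum_rank u)) GE.
rewrite !mxE enum_rankK /mask Pu => ->.
rewrite (reindex_onto enum_rank enum_val) /=; last by move=> w _; rewrite enum_valK.
apply: eq_big => [w|w _]; first by rewrite enum_rankK eqxx.
by rewrite mxE !enum_rankK /mask Pu.
Qed.

Section Surjectivity.
Variables (n : nat) (K : fieldType) (I : {mpoly K[n]} -> Prop) (d : nat).
Hypothesis charK : [pchar K] =i pred0.
Hypothesis I_monomial : monomial_ideal I.
Hypothesis I_pure : forall i, I 'X_[U_(i) *+ d].
Hypothesis I_sparse : forall (k i j : 'I_n) (c : 'X_{1..n}),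
  i != k -> j != k -> i != j -> c k = 0%N ->
  mdeg (c + U_(i))%MM = d -> ~ I 'X_[c + U_(i)] -> I 'X_[c + U_(j)].
Variable y : 'I_n.

Let ell : {mpoly K[n]} := \sum_(i < n) 'X_i.
Local Notation T := 'X_{1..n < d.+1}.
(** The monomials that form a basis of (S/I)_d. *)
Let outI (m : 'X_{1..n}) : bool :=
  (mdeg m == d) && ~~ (if excluded_middle_informative (I 'X_[m]) then true else false).

Lemma outIP m : reflect (mdeg m = d /\ ~ I 'X_[m]) (outI m).
Proof.
rewrite /outI; case: excluded_middle_informative => Im; rewrite ?andbF ?andbT.
  by constructor=> -[].
by apply: (iffP eqP) => [|[]].
Qed.

Lemma mcoeff_ellM f m :
  (ell * f)@_m = \sum_(i < n) if m i == 0%N then 0 else f@_(m - U_(i))%MM.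
Proof. by rewrite mulr_suml raddf_sum; apply: eq_bigr => i _; rewrite /= mcoeffXM. Qed.

Lemma functional0 (phi : T -> K) :
  (forall t : T, \sum_(u : T | outI u) (ell * 'X_[t])@_u * phi u = 0) ->
  forall u : T, outI u -> phi u = 0.
Proof.
move=> phi_ell.
(* The extension of phi by zero to unbounded monomials. *)
pose Phi (m : 'X_{1..n})   := \sum_(u : T | outI u) (m == u)%:R * phi u.
have PhiE (u : T) : outI u -> Phi u = phi u.
  move=> Pu; rewrite /Phi (bigD1 u) //= eqxx mul1r big1 ?addr0 // => w /andP[_ wu].
  by rewrite -bmeqP eq_sym (negPf wu) mul0r.
have Phi_neq0 m : Phi m != 0 -> mdeg m = d /\ ~ I 'X_[m].
  move=> Phim; have [u /andP[/outIP Pu /eqP ->] //] : exists u : T, outI u && (m == u).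
  apply/existsP; apply: contraR Phim; rewrite negb_exists => /forallP Nm.
  rewrite /Phi big1 // => u Pu; have := Nm u; rewrite Pu => /= /negPf->.
  by rewrite mul0r.
have Phi0 m : I 'X_[m] -> Phi m = 0.
  by move=> Im; apply/eqP; apply: contra_notT (fun NI => (Phi_neq0 m NI).2) _.
move=> u Pu; rewrite -PhiE //.
apply: (sparse_functional0 (d := d) charK _ _ _ _ y).
- by move=> m /Phi_neq0[].
- move=> c; have [cd|dc] := ltnP (mdeg c) d.+1; last first.
    rewrite big1 // => i _; apply/eqP; apply: contraTT dc => /Phi_neq0[<- _].
    by rewrite mdegD mdeg1 addn1 -ltnNge ltnW.
  rewrite -[RHS](phi_ell (BMultinom cd)) exchange_big; apply: eq_bigr => w Pw /=.
  rewrite -mulr_suml; congr (_ * _); rewrite mulr_suml raddf_sum; apply: eq_bigr => i _ /=.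
  by rewrite -mpolyXD mcoeffX addmC.
- by move=> i; apply: Phi0.
- by move=> k i j c ik jk ij ck /Phi_neq0[cd NI]; apply/Phi0/(I_sparse ik).
Qed.

Lemma ell_homog : ell \is 1.-homog.
Proof. by apply: rpred_sum => i _; rewrite dhomogX; apply/eqP/mdeg1. Qed.

Lemma ell_surjective j : j.+1 = d -> mul_surjective I ell j.
Proof.
move=> jd g g_homog.
have [v vE] := solvable_of_dual_injective functional0 (fun u : T => g@_u).
pose f := mpoly_restrict (fun m => mdeg m == j) (\sum_(t : T) v t *: 'X_[t]).
have f_homog : f \is j.-homog.
  apply/dhomogP=> m; rewrite mcoeff_msupp mcoeff_restrict.
  by case: (eqVneq (mdeg m) j) => //=; rewrite eqxx.
exists f => //; apply/monomial_idealP => // m m_gf; apply: NNPP => NIm.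
have md : mdeg m = d.
  have: g - ell * f \is d.-homog.
    rewrite -jd; apply: rpredB => //; rewrite -add1n; exact: dhomogM ell_homog f_homog.
  by move/dhomogP => /(_ m m_gf).
have md1 : (mdeg m < d.+1)%N by rewrite md.
move: m_gf; rewrite mcoeff_msupp mcoeffB subr_eq0 => /eqP; apply.
have -> := vE (BMultinom md1); last by apply/outIP.
transitivity ((ell * \sum_t v t *: 'X_[t])@_m).
  rewrite mulr_sumr raddf_sum; apply: eq_bigr => t _ /=.
  by rewrite -scalerAr mcoeffZ.
rewrite !mcoeff_ellM; apply: eq_bigr => i _; case: (eqVneq (m i) 0%N) => // mi.
rewrite mcoeff_restrict; case: eqP => // -[].
move: md; rewrite -{1}(mnm_predK (m := m) (i := i)) ?lt0n // mdegD mdeg1 -jd addn1.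
by case.
Qed.
End Surjectivity.

(** * The weak Lefschetz property *)

Theorem theorem4p6 (K : fieldType) (charK : [pchar K] =i pred0) (n d : nat)
  (I : {mpoly K[n]} -> Prop)
  (I_monomial : monomial_ideal I)
  (I_degree : generated_in_degree I d)
  (I_power : forall f : {mpoly K[n]},
     ideal_exp (@irrelevant_ideal n K) d.+1 f -> I f)
  (F : free_complex n K)
  (F_resolution : minimal_free_resolution I F)
  (F_linear : linear_for_steps F d (n - 2)) :
  weak_lefschetz I.
Proof.
exists (\sum_(i < n) 'X_i); first exact: ell_homog.
move=> j.
case: (pickP (@predT 'I_n)) => [y _|no_var]; last first.
  right=> g /dhomogP g_homog; exists 0; first exact: rpred0.
  rewrite mulr0 subr0; apply/monomial_idealP => // m /g_homog.
  by rewrite /= mdegE big1 // => i; have := no_var i.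
case: (ltngtP j.+1 d) => jd.
- left=> f f_homog Ilf.
  have l_neq0 : \sum_(i < n) 'X_i != 0 :> {mpoly K[n]}.
    apply: contraTneq (oner_neq0 K) => /(congr1 (mcoeff U_(y))).
    rewrite mcoeff0 raddf_sum (bigD1 y) //= mcoeffXU eqxx big1 ?addr0 => [one0|i iy].
      by rewrite negbK; apply/eqP.
    by rewrite mcoeffXU (negPf iy).
  have : (\sum_(i < n) 'X_i) * f == 0.
    apply/eqP/msuppnil0; case E: (msupp _) => [//|m s].
    have m_lf : m \in msupp ((\sum_(i < n) 'X_i) * f) by rewrite E mem_head.
    have := ideal_mdeg_ge I_degree ((monomial_idealP I_monomial _).1 Ilf m m_lf).
    have /dhomogP/(_ m m_lf) -> := dhomogM (ell_homog n K) f_homog.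
    by rewrite add1n leqNgt jd.
  by rewrite mulf_eq0 (negPf l_neq0) => /eqP ->; apply: ideal0.
- right=> g g_homog; exists 0; first exact: rpred0.
  rewrite mulr0 subr0; apply/monomial_idealP => // m /(dhomogP _ _ _ g_homog) md.
  by apply: (ideal_mdeg_gt I_power); rewrite md.
- right; apply: (ell_surjective charK I_monomial _ _ y jd).
  + by move=> i; apply: (ideal_pure_power I_degree I_power).
  + by move=> k i l c; apply: (sparse_complement I_monomial I_power F_resolution F_linear).
Qed.
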